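(* Let $n\ge 3$ and $0\le k\le n$ be integers and let $\lambda,\mu,\nu\in\Pi_{k,n}$. Let $\Gamma_\lambda(\mu,\nu)$ be the set of dimer configurations (perfect matchings) on the honeycomb cylinder of circumference $n$ and height $k$ with bottom boundary string $b^{in}=b^\mu$, top boundary string $b^{out}=b^\nu$ and exactly $\lambda_t$ horizontal dimers in row $t$ for $t=1,\dots,k$. Then: (i) If $\alpha=(\alpha_1,\dots,\alpha_k)$ is any permutation of the parts $(\lambda_1,\dots,\lambda_k)$ of $\lambda$ (zero parts included), then $|\Gamma_\lambda(\mu,\nu)|=|\Gamma_\alpha(\mu,\nu)|$. (ii) $|\Gamma_\lambda(\mu,\nu)|=0$ unless $|\lambda|+|\mu|-|\nu|$ is divisible by $n$. (iii) If $|\Gamma_\lambda(\mu,\nu)|>0$, then in each perfect matching in $\Gamma_\lambda(\mu,\nu)$ precisely $$d=\frac{|\lambda|+|\mu|-|\nu|}{n}$$ horizontal dimers cross the boundary.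
   Context: Partitions and binary strings. $\Pi_{k,n}$ is the set of partitions $\mu=(\mu_1\ge\dots\ge\mu_k\ge 0)$ with $\mu_1\le n-k$; $|\mu|=\sum_i\mu_i$. It is identified with the set of binary strings $b=b_n\cdots b_2b_1$ of length $n$ with exactly $k$ one-letters via $\mu\mapsto b^\mu$, where $b^\mu_j=1$ if and only if $j\in\{\mu_{k+1-i}+i : 1\le i\le k\}$. Lattice. The honeycomb lattice on the cylinder with circumference $n$ and height $k$ has rows $t=1,\dots,k$ (numbered from bottom to top); row $t$ is a zigzag cycle of $2n$ vertices $D_{t,j},U_{t,j}$ with $j\in\mathbb{Z}/n\mathbb{Z}$ (representatives $1,\dots,n$). The edges are: edges joining $D_{t,j}$ and $U_{t,j}$; ''horizontal'' edges joining $U_{t,j}$ and $D_{t,j+1}$; vertical edges joining $U_{t,j}$ and $D_{t+1,j}$ for $1\le t\le k-1$; and, in addition, for each $j$ a bottom edge labelled $j$ attached only to $D_{1,j}$ and a top edge labelled $j$ attached only to $U_{k,j}$. The boundary is the vertical line separating columns $n$ and $1$; the horizontal edges crossing it are those joining $U_{t,n}$ and $D_{t,1}$. Dimers. A perfect matching (dimer configuration) is a set of edges, called dimers (bottom and top edges may be selected), such that every vertex $D_{t,j},U_{t,j}$ lies on exactly one selected edge. Its boundary strings are $b^{in}$ with $b^{in}_j=1$ iff the bottom edge $j$ is selected, and $b^{out}$ with $b^{out}_j=1$ iff the top edge $j$ is selected. For a $k$-tuple $\alpha=(\alpha_1,\dots,\alpha_k)$ of integers with $0\le\alpha_t\le n-k$,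 $\Gamma_\alpha(\mu,\nu)$ is the set of perfect matchings with $b^{in}=b^\mu$, $b^{out}=b^\nu$ and exactly $\alpha_t$ selected horizontal edges in row $t$, $t=1,\dots,k$. (For $k=0$ there is just the empty matching.) *)

(* Defs.v *)
From HB Require Import structures.
From mathcomp Require Import all_boot all_order all_algebra.

Set Implicit Arguments.
Unset Strict Implicit.
Unset Printing Implicit Defensive.

(* Indices are shifted to start at 0 throughout: a row [t : 'I_k], a column    *)
(* [j : 'I_n] and a part index [i : 'I_k] stand for t + 1, j + 1 and i + 1.    *)

Definition in_Pi (k n : nat) (mu : k.-tuple nat) : bool :=
  sorted geq mu && all (fun m => m <= n - k) mu.

(* With 1-based indices: b_j = 1 iff j = mu_(k+1-i) + i for some 1 <= i <= k.  *)
Definition bstring (k n : nat) (mu : k.-tuple nat) : {ffun 'I_n -> bool} :=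
  [ffun j : 'I_n => [exists i : 'I_k, j.+1 == tnth mu (rev_ord i) + i.+1]].

Inductive vertex (k n : nat) : Type :=
  | Dvx of 'I_k & 'I_n
  | Uvx of 'I_k & 'I_n.
Arguments Dvx {k n}.
Arguments Uvx {k n}.

(* [Rung t j] joins D_(t,j) and U_(t,j); [Horiz t j] joins U_(t,j) and         *)
(* D_(t,j+1), cyclically in j; [Vert t j] joins U_(t,j) and D_(t+1,j).         *)
Inductive edge (k n : nat) : Type :=
  | Rung of 'I_k & 'I_n
  | Horiz of 'I_k & 'I_n
  | Vert of 'I_k.-1 & 'I_n
  | Bottom of 'I_n
  | Top of 'I_n.
Arguments Rung {k n}.
Arguments Horiz {k n}.
Arguments Vert {k n}.
Arguments Bottom {k n}.
Arguments Top {k n}.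

Section VertexFinType.
Variables k n : nat.

Definition vertex_code (v : vertex k n) : 'I_k * 'I_n + 'I_k * 'I_n :=
  match v with Dvx t j => inl (t, j) | Uvx t j => inr (t, j) end.

Definition vertex_decode (c : 'I_k * 'I_n + 'I_k * 'I_n) : vertex k n :=
  match c with inl (t, j) => Dvx t j | inr (t, j) => Uvx t j end.

Lemma vertex_codeK : cancel vertex_code vertex_decode.
Proof. by case. Qed.

HB.instance Definition _ := Finite.copy (vertex k n) (can_type vertex_codeK).

End VertexFinType.

Section EdgeFinType.
Variables k n : nat.

Let code_type : Type :=
  ('I_k * 'I_n + 'I_k * 'I_n + ('I_k.-1 * 'I_n + ('I_n + 'I_n)))%type.

Definition edge_code (e : edge k n) : code_type :=
  match e with
  | Rung t j => inl (inl (t, j))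
  | Horiz t j => inl (inr (t, j))
  | Vert t j => inr (inl (t, j))
  | Bottom j => inr (inr (inl j))
  | Top j => inr (inr (inr j))
  end.

Definition edge_decode (c : code_type) : edge k n :=
  match c with
  | inl (inl (t, j)) => Rung t j
  | inl (inr (t, j)) => Horiz t j
  | inr (inl (t, j)) => Vert t j
  | inr (inr (inl j)) => Bottom j
  | inr (inr (inr j)) => Top j
  end.

Lemma edge_codeK : cancel edge_code edge_decode.
Proof. by case. Qed.

HB.instance Definition _ := Finite.copy (edge k n) (can_type edge_codeK).

End EdgeFinType.

Definition incident (k n : nat) (v : vertex k n) (e : edge k n) : bool :=
  match v, e with
  | Dvx s i, Rung t j => (s == t) && (i == j)
  | Uvx s i, Rung t j => (s == t) && (i == j)
  | Uvx s i, Horiz t j => (s == t) && (i == j)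
  | Dvx s i, Horiz t j => (s == t) && (i == ordS j)
  | Uvx s i, Vert t j => (s == t :> nat) && (i == j)
  | Dvx s i, Vert t j => (s == t.+1 :> nat) && (i == j)
  | Dvx s i, Bottom j => (s == 0 :> nat) && (i == j)
  | Uvx s i, Top j => (s.+1 == k) && (i == j)
  | _, _ => false
  end.

Definition perfect_matching (k n : nat) (M : {set edge k n}) : bool :=
  [forall v : vertex k n, #|[set e in M | incident v e]| == 1].

Definition b_in (k n : nat) (M : {set edge k n}) : {ffun 'I_n -> bool} :=
  [ffun j => Bottom j \in M].

Definition b_out (k n : nat) (M : {set edge k n}) : {ffun 'I_n -> bool} :=
  [ffun j => Top j \in M].

Definition horiz_in_row (k n : nat) (M : {set edge k n}) (t : 'I_k) : nat :=
  #|[set j : 'I_n | Horiz t j \in M]|.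

(* For k = 0 the strings of mu and nu vanish, so that only the empty matching  *)
(* is left.                                                                    *)
Definition Gamma (k n : nat) (alpha mu nu : k.-tuple nat) :
    {set {set edge k n}} :=
  [set M | [&& perfect_matching M,
               b_in M == bstring n mu,
               b_out M == bstring n nu
             & [forall t : 'I_k, horiz_in_row M t == tnth alpha t]]].

Definition crossings (k n : nat) (M : {set edge k n}) : nat :=
  #|[set p : 'I_k * 'I_n | (p.2.+1 == n) && (Horiz p.1 p.2 \in M)]|.

(* Main.v *)
Require Import Defs.
From mathcomp Require Import all_boot all_order all_algebra.
From mathcomp Require Import ring.

(* Read a row of the honeycomb as a transfer matrix T_a on binary strings,     *)
(* where a is the number of horizontal dimers; then |Gamma_alpha(mu, nu)| is   *)
(* the (b^mu, b^nu) entry of T_(alpha_1) ... T_(alpha_k), and (i) amounts to   *)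
(* T_a T_d = T_d T_a.  Weight a horizontal dimer by x in the lower of two      *)
(* consecutive rows and by y in the upper one: the two-row partition function  *)
(* with prescribed outer strings is the trace of a product of 4x4 matrices,    *)
(* one per column.  A single intertwiner (Yang-Baxter) conjugates each of them *)
(* to the one with x and y exchanged, so the trace is symmetric in x and y.    *)
(* For (ii) and (iii), at each site b_j + h_(j-1) = h_j + c_j, where b, c, h   *)
(* record the dimers below, above and along the row.  Summing j times this     *)
(* over the row shows that the sum of the positions grows by the number of     *)
(* horizontal dimers minus n for each boundary crossing.                       *)

Set Implicit Arguments.
Unset Strict Implicit.
Unset Printing Implicit Defensive.

Import GRing.Theory Num.Theory.
Local Open Scope ring_scope.

(** [trace_two_row] evaluates two rows column by column, [trace_swap] exchanges their weights by the
    intertwiner, and comparing coefficients ([coef_two_row_sum]) gives [transfer_comm]. In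
    [card_Gamma] a matching becomes a path of strings, its rungs being forced, so permuting [alpha]
    permutes commuting factors. For the rest, [row_displacement] telescopes to [total_displacement];
    with [bstring_weight] every matching satisfies |nu| + n d = |mu| + |lambda|
    ([Gamma_displacement]), d being its number of crossings. *)

(** * Matrix products and traces as sums over paths *)

Section KernelMatrices.
Variables (R : comNzRingType) (A : finType).
Implicit Types (M N : 'M[R]_#|A|) (a b c : A).

Definition kernel_mx (K : A -> A -> R) : 'M[R]_#|A| :=
  \matrix_(i, j) K (enum_val i) (enum_val j).

Definition entry M a b := M (enum_rank a) (enum_rank b).

Lemma kernel_mxE K a b : entry (kernel_mx K) a b = K a b.
Proof. by rewrite /entry mxE !enum_rankK. Qed.

Lemma eq_entry M N : (forall a b, entry M a b = entry N a b) -> M = N.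
Proof.
move=> eqMN; apply/matrixP=> i j.
by have := eqMN (enum_val i) (enum_val j); rewrite /entry !enum_valK.
Qed.

Lemma entry_mul M N a c : entry (M * N) a c = \sum_b entry M a b * entry N b c.
Proof.
rewrite /entry mxE (reindex (@enum_rank A)) //=.
exact: onW_bij (enum_rank_bij A).
Qed.

Lemma entry1 a b : entry 1 a b = (a == b)%:R.
Proof. by rewrite /entry mxE (inj_eq enum_rank_inj). Qed.

Lemma entry_trace M : \tr M = \sum_a entry M a a.
Proof.
rewrite /mxtrace (reindex (@enum_rank A)) //=.
exact: onW_bij (enum_rank_bij A).
Qed.

Lemma entry_prod k (M : 'I_k -> 'M[R]_#|A|) a c :
  entry (\prod_i M i) a c =
  \sum_(s : {ffun 'I_k.+1 -> A} | (s ord0 == a) && (s ord_max == c))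
    \prod_i entry (M i) (s (widen_ord (leqnSn k) i)) (s (lift ord0 i)).
Proof.
elim: k M c => [|k IHk] M c.
  rewrite big_ord0 entry1; under eq_bigr do rewrite big_ord0.
  have [->|neq_ac] := eqVneq a c; last first.
    rewrite big1 // => s /andP[/eqP sa /eqP sc].
    by case/eqP: neq_ac; rewrite -sa -sc; congr (s _); apply: val_inj.
  rewrite (big_pred1 [ffun => c]) //= => s.
  apply/andP/eqP => [[/eqP sc _]|->]; last by rewrite !ffunE eqxx.
  by apply/ffunP=> i; rewrite ffunE (ord1 i).
(* [lift ord_max] keeps the value of an index, so [ext] appends a last state to a path. *)
pose ext (p : {ffun 'I_k.+1 -> A} * A) : {ffun 'I_k.+2 -> A} :=
  [ffun i => if unlift ord_max i is Some j then p.1 j else p.2].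
pose res (s : {ffun 'I_k.+2 -> A}) := ([ffun j => s (lift ord_max j)], s ord_max).
have ext_max p : ext p ord_max = p.2 by rewrite ffunE unlift_none.
have ext_lift p j : ext p (lift ord_max j) = p.1 j by rewrite ffunE liftK.
have ext_bij : bijective ext.
  exists res => [[s b]|s].
    by congr (_, _); [apply/ffunP=> j; rewrite ffunE ext_lift | exact: ext_max].
  apply/ffunP=> i; case: (unliftP ord_max i) => [j|] ->.
    by rewrite ext_lift ffunE.
  by rewrite ext_max.
rewrite big_ord_recr entry_mul (reindex ext); last exact: onW_bij.
have ext0 p : ext p ord0 = p.1 ord0.
  by rewrite -ext_lift; congr (ext p _); apply: val_inj.
under eq_bigl do rewrite ext0 ext_max.
transitivity (\sum_(p : {ffun 'I_k.+1 -> A} * A | (p.1 ord0 == a) && (p.2 == c))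
    (\prod_i entry (M (widen_ord (leqnSn k) i)) (p.1 (widen_ord (leqnSn k) i))
        (p.1 (lift ord0 i))) * entry (M ord_max) (p.1 ord_max) p.2).
  rewrite -(pair_big (fun s : {ffun 'I_k.+1 -> A} => s ord0 == a) (pred1 c)
    (fun s b => (\prod_i entry (M (widen_ord (leqnSn k) i))
      (s (widen_ord (leqnSn k) i)) (s (lift ord0 i))) *
        entry (M ord_max) (s ord_max) b)) /=.
  rewrite (partition_big (fun s : {ffun 'I_k.+1 -> A} => s ord_max) predT) //=.
  apply: eq_bigr => b _; rewrite IHk big_distrl /=.
  by apply: eq_bigr => s /andP[_ /eqP ->]; rewrite big_pred1_eq.
apply: eq_bigr => p _; rewrite big_ord_recr /=; congr (_ * _); last first.
  congr entry; last by rewrite -ext_max; congr (ext p _); apply: val_inj.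
  rewrite -ext_lift; congr (ext p _); apply: val_inj => /=.
  by rewrite /bump ltnNge leqnn.
apply: eq_bigr => i _; congr entry; rewrite -ext_lift; congr (ext p _).
  apply: val_inj => /=; rewrite /bump leqNgt.
  by rewrite (ltn_trans (ltn_ord i)) ?ltnS.
apply: val_inj => /=; rewrite /bump /= !add1n leqNgt.
by rewrite ltnS ltn_ord.
Qed.

(** The trace closes the path into a cycle: [ord_pred] wraps around, matching the periodicity of the
    cylinder. *)
Lemma trace_prod n (M : 'I_n.+1 -> 'M[R]_#|A|) :
  \tr (\prod_i M i) =
  \sum_(s : {ffun 'I_n.+1 -> A}) \prod_i entry (M i) (s (ord_pred i)) (s i).
Proof.
rewrite big_ord_recl entry_trace.
under eq_bigr do rewrite entry_mul.
rewrite pair_big /=.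
rewrite (partition_big (fun s : {ffun 'I_n.+1 -> A} => (s ord_max, s ord0)) predT) //=.
apply: eq_bigr => -[c a] _ /=; rewrite entry_prod big_distrr /=.
apply: eq_big => [s|s /andP[/eqP sa /eqP sc]].
  by rewrite xpair_eqE andbC.
rewrite big_ord_recl; congr (_ * _).
  rewrite -sa -sc; congr (entry _ (s _) _); apply: val_inj => /=.
  by rewrite modn_small.
apply: eq_bigr => i _; congr (entry _ (s _) _); apply: val_inj => /=.
by rewrite modnDr modn_small; last exact: ltnW (ltn_ord (lift ord0 i)).
Qed.

End KernelMatrices.

(** * The intertwiner for two rows *)

Section YangBaxter.
Variables (R : idomainType).

(* [b] and [c] are the dimers below and above the column, [h] and [h'] the     *)
(* horizontal dimers entering from the left and leaving to the right; the rung *)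
(* is present iff [b + h = 0].                                                 *)
Definition site (b h h' c : bool) := (b + h == h' + c)%N && (b + h <= 1)%N.

(** The bit [m] is the vertical dimer between the two rows. Only outgoing dimers are weighted, so
    each horizontal edge counts once around the cycle. *)
Definition two_row_weight (x y : R) (b c : bool) (g g' : bool * bool) : R :=
  \sum_(m : bool) (site b g.1 g'.1 m && site m g.2 g'.2 c)%:R *
                  (x ^+ g'.1 * y ^+ g'.2).

(* The intertwiner (R-matrix), scaled by [y] so that no division is needed.    *)
Definition swapper (x y : R) (g g' : bool * bool) : R :=
  match g, g' with
  | (false, false), (false, false) => y
  | (true, false), (true, false) => y
  | (false, true), (true, false) => y - x
  | (false, true), (false, true) => x
  | (true, true), (true, true) => x
  | _, _ => 0
  end.

Lemma sum_bool2 (F : bool * bool -> R) :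
  \sum_g F g = F (true, true) + F (true, false) + (F (false, true) + F (false, false)).
Proof.
transitivity (\sum_(g : bool * bool) F (g.1, g.2)).
  by apply: eq_bigr => -[].
by rewrite -(pair_bigA _ (fun a b => F (a, b))) /= !big_bool.
Qed.

(** The point is that [swapper] does not depend on [b] and [c], so it passes through a whole product
    of columns. The identity is a finite check over six bits. *)
Lemma swapper_commute x y b c :
  kernel_mx (two_row_weight x y b c) * kernel_mx (swapper x y) =
  kernel_mx (swapper x y) * kernel_mx (two_row_weight y x b c).
Proof.
apply: eq_entry => -[a1 a2] [d1 d2]; rewrite !entry_mul.
under eq_bigr do rewrite !kernel_mxE /two_row_weight.
under [RHS]eq_bigr do rewrite !kernel_mxE /two_row_weight.
rewrite !sum_bool2 !big_bool.
by case: a1; case: a2; case: d1; case: d2; case: b; case: c;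
  rewrite /= ?expr1 ?expr0; ring.
Qed.

Lemma swapperK x y :
  kernel_mx (swapper x y) * kernel_mx (swapper y x) = (x * y)%:M.
Proof.
apply: eq_entry => -[a1 a2] [d1 d2]; rewrite !entry_mul.
under eq_bigr do rewrite !kernel_mxE.
rewrite !sum_bool2 /entry mxE (inj_eq enum_rank_inj).
by case: a1; case: a2; case: d1; case: d2;
  rewrite /= ?mulr1n ?mulr0n; ring.
Qed.

Lemma trace_swap n (b c : 'I_n -> bool) x y : x != 0 -> y != 0 ->
  \tr (\prod_i kernel_mx (two_row_weight x y (b i) (c i))) =
  \tr (\prod_i kernel_mx (two_row_weight y x (b i) (c i))).
Proof.
move=> x0 y0; set P := \prod_i _; set Q := \prod_i _.
set G := kernel_mx (swapper x y); set H := kernel_mx (swapper y x).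
have PG : P * G = G * Q.
  rewrite /P /Q; elim/big_rec2: _ => [|i B D _ IH]; first by rewrite mul1r mulr1.
  by rewrite -mulrA IH !mulrA swapper_commute.
have HG : H * G = (x * y)%:M.
  by rewrite swapperK mulrC.
(* The factor [x * y] is written as [G * H] on one side and [H * G] on the other; then
   [P * G = G * Q] and cyclicity of the trace finish without inverting [G]. *)
apply: (@mulfI _ (x * y)); first by rewrite mulf_neq0.
rewrite -!mxtraceZ -!mul_mx_scalar -[in LHS]swapperK -/G -/H -HG.
rewrite [P *m _]mulrA PG.
by rewrite -[G * Q * H]mulrA [LHS]mxtrace_mulC -mulmxA.
Qed.

End YangBaxter.

(** * Commuting row transfer matrices *)

Section Transfer.
Variable n : nat.
Local Notation bits := {ffun 'I_n.+1 -> bool}.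

Definition row_ok (b h c : bits) :=
  [forall j, site (b j) (h (ord_pred j)) (h j) (c j)].

Definition transfer (a : nat) : 'M[int]_#|bits| :=
  kernel_mx (fun b c : bits =>
    \sum_(h : bits) (row_ok b h c && (\sum_j h j == a)%N)%:R).

Definition two_row_sum (R : comNzRingType) (x y : R) (b c : bits) : R :=
  \sum_(m : bits) \sum_(h1 : bits) \sum_(h2 : bits)
    (row_ok b h1 m && row_ok m h2 c)%:R *
    (x ^+ (\sum_j h1 j)%N * y ^+ (\sum_j h2 j)%N).

Lemma prodr_nat_bool (R : comNzRingType) (I : finType) (P : pred I) :
  \prod_i (P i)%:R = [forall i, P i]%:R :> R.
Proof.
case: forallP => [allP | /forallP].
  by rewrite big1 // => i _; rewrite allP.
by rewrite negb_forall => /existsP[i /negPf Pi]; rewrite (bigD1 i) //= Pi mul0r.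
Qed.

Lemma trace_two_row (R : idomainType) (x y : R) (b c : bits) :
  \tr (\prod_i kernel_mx (two_row_weight x y (b i) (c i))) = two_row_sum x y b c.
Proof.
rewrite trace_prod.
under eq_bigr => s _.
  under eq_bigr do rewrite kernel_mxE /two_row_weight.
  rewrite bigA_distr_bigA /=.
  over.
rewrite exchange_big /=; apply: eq_bigr => m _.
pose glue (p : bits * bits) : {ffun 'I_n.+1 -> bool * bool} :=
  [ffun i => (p.1 i, p.2 i)].
rewrite (reindex glue); last first.
  exists (fun s : {ffun _ -> bool * bool} =>
    ([ffun i => (s i).1], [ffun i => (s i).2])) => [[h1 h2] _|s _].
    by congr (_, _); apply/ffunP=> i; rewrite !ffunE.
  by apply/ffunP=> i; rewrite !ffunE; case: (s i).
rewrite pair_bigA; apply: eq_bigr => -[h1 h2] _ /=.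
under eq_bigr do rewrite !ffunE /=.
rewrite big_split big_split /= !prodrXr prodr_nat_bool; congr ((nat_of_bool _)%:R * _).
apply/idP/andP => [/forallP ok | [/forallP ok1 /forallP ok2]].
  by split; apply/forallP=> j; case/andP: (ok j).
by apply/forallP=> j; rewrite ok1 ok2.
Qed.

(** In Z[x][y] the inner variable is ['X%:P] and the outer one ['X]. Exchanging them while reading
    the same coefficient exchanges the numbers of horizontal dimers in the two rows. *)
Lemma coef_two_row_sum a d b c :
  (two_row_sum 'X%:P 'X b c)`_d`_a = entry (transfer a * transfer d) b c /\
  (two_row_sum 'X 'X%:P b c)`_d`_a = entry (transfer d * transfer a) b c.
Proof.
have coefXY (e : bool) i j :
    ((e%:R * ('X%:P ^+ i * 'X ^+ j) : {poly {poly int}})`_d)`_a =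
    (e && (i == a) && (j == d))%:R.
  rewrite mulr_natl !coefMn -polyC_exp coefCM coefXn mulr_natr coefMn coefXn.
  rewrite (eq_sym a) (eq_sym d).
  by case: e; case: (i == a); case: (j == d).
rewrite !entry_mul; split; rewrite !coef_sum; apply: eq_bigr => m _.
  rewrite !kernel_mxE big_distrlr /= !coef_sum; apply: eq_bigr => h1 _.
  rewrite !coef_sum; apply: eq_bigr => h2 _.
  by rewrite coefXY -natrM mulnb -andbA andbACA.
rewrite !kernel_mxE big_distrlr /= !coef_sum; apply: eq_bigr => h1 _.
rewrite !coef_sum; apply: eq_bigr => h2 _.
rewrite [X in _ * X]mulrC coefXY -natrM mulnb; congr (_%:R).
by rewrite -andbA [X in _ && X]andbC andbACA.
Qed.

Lemma transfer_comm a d : transfer a * transfer d = transfer d * transfer a.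
Proof.
apply: eq_entry => b c; have [<- <-] := coef_two_row_sum a d b c.
by rewrite -!trace_two_row trace_swap ?polyC_eq0 ?polyX_eq0.
Qed.

Lemma transfer_perm (s1 s2 : seq nat) : perm_eq s1 s2 ->
  \prod_(a <- s1) transfer a = \prod_(a <- s2) transfer a.
Proof.
move=> s12; pose P s := \prod_(a <- s1) transfer a = \prod_(a <- s) transfer a.
apply: (@catCA_perm_ind _ P _ _ _ s12) => // u v w; rewrite /P => ->.
have com : GRing.comm (\prod_(a <- u) transfer a) (\prod_(a <- v) transfer a).
  apply: commr_prod => a _; apply/commr_sym; apply: commr_prod => d _.
  exact: transfer_comm.
by rewrite !big_cat /= !mulrA com.
Qed.

End Transfer.

(** * Perfect matchings as local conditions at vertices *)

Section Matchings.
Variables k n : nat.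
Local Notation bits := {ffun 'I_n -> bool}.
Implicit Types (M : {set edge k n}) (t : 'I_k) (j : 'I_n).

(* The edge between row [t - 1] and row [t]: a bottom edge for [t = 0], a top  *)
(* edge for [t = k].                                                           *)
Definition level (t : nat) j : edge k n :=
  if t is s.+1 then if insub s is Some s' then Vert s' j else Top j
  else Bottom j.

Lemma levelS (s : 'I_k.-1) j : level s.+1 j = Vert s j.
Proof. by rewrite /level valK. Qed.

Lemma level_top j : (0 < k)%N -> level k j = Top j.
Proof.
rewrite /level; case: k => // k' _.
by case: insubP => //= s; rewrite ltnn.
Qed.

Lemma incident_D t j e :
  incident (Dvx t j) e = (e \in [:: Rung t j; Horiz t (ord_pred j); level t j]).
Proof.
rewrite !inE; apply/idP/idP => [|/or3P[] /eqP->].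
- case: e => //= [s i|s i|s i|i] /andP[/eqP ts /eqP ->].
  + by rewrite ts eqxx.
  + by rewrite ts ordSK eqxx.
  + by rewrite ts levelS ?eqxx ?orbT.
  + by rewrite ts ?eqxx ?orbT.
- by rewrite /= !eqxx.
- by rewrite /= ord_predK !eqxx.
case Et: (val t) => [|s]; first by rewrite /= Et !eqxx.
have lt_s : (s < k.-1)%N by rewrite ltn_predRL -Et ltn_ord.
by rewrite /= insubT /= Et !eqxx.
Qed.

Lemma incident_U t j e :
  incident (Uvx t j) e = (e \in [:: Rung t j; Horiz t j; level t.+1 j]).
Proof.
have k_gt0 : (0 < k)%N by apply: leq_trans (ltn_ord t).
rewrite !inE; apply/idP/idP => [|/or3P[] /eqP->].
- case: e => [s i|s i|s i|i|i] //= /andP[/eqP ts /eqP ->].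
  + by rewrite ts eqxx.
  + by rewrite ts eqxx.
  + by rewrite ts valK ?eqxx ?orbT.
  + by rewrite -/(level t.+1 i) ts level_top // ?eqxx ?orbT.
- by rewrite /= !eqxx.
- by rewrite /= !eqxx.
rewrite /=; case: insubP => [s _ ->|]; first by rewrite !eqxx.
rewrite ltn_predRL -leqNgt => le_k.
by rewrite eqn_leq le_k ltn_ord eqxx.
Qed.

Lemma card_set_seq (T : finType) (A : {set T}) (P : pred T) (l : seq T) :
  uniq l -> P =i l -> #|[set x in A | P x]| = (\sum_(x <- l) (x \in A))%N.
Proof.
move=> l_uniq Pl; rewrite big_uniq //= [RHS]big_mkcond -sum1_card [LHS]big_mkcond /=.
apply: eq_bigr => x _; rewrite inE; have <- : P x = (x \in l) := Pl x.
by case: (x \in A); case: (P x).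
Qed.

Definition vertex_ok (r h v : bool) := (r + h + v == 1)%N.

Lemma perfect_matchingE M : perfect_matching M =
  [forall t, forall j,
    vertex_ok (Rung t j \in M) (Horiz t (ord_pred j) \in M) (level t j \in M) &&
    vertex_ok (Rung t j \in M) (Horiz t j \in M) (level t.+1 j \in M)].
Proof.
have uniq3 t i j s : uniq [:: Rung t j; Horiz t i; level s j].
  by rewrite /= !inE /level; case: s => [|s] //; case: insub.
have degD t j : (#|[set e in M | incident (Dvx t j) e]| == 1)%N =
    vertex_ok (Rung t j \in M) (Horiz t (ord_pred j) \in M) (level t j \in M).
  rewrite (card_set_seq _ (uniq3 t (ord_pred j) j t)) => [|e].
    by rewrite !big_cons big_nil addn0 addnA.
  exact: incident_D.
have degU t j : (#|[set e in M | incident (Uvx t j) e]| == 1)%N =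
    vertex_ok (Rung t j \in M) (Horiz t j \in M) (level t.+1 j \in M).
  rewrite (card_set_seq _ (uniq3 t j j t.+1)) => [|e].
    by rewrite !big_cons big_nil addn0 addnA.
  exact: incident_U.
apply/forallP/forallP => [ok t | ok [] t j].
- by apply/forallP=> j; rewrite -degD -degU !ok.
- by rewrite degD; have /forallP/(_ j)/andP[] := ok t.
- by rewrite degU; have /forallP/(_ j)/andP[] := ok t.
Qed.

Lemma vertex_ok_site (r b h h' c : bool) :
  vertex_ok r h b -> vertex_ok r h' c -> site b h h' c.
Proof. by move: r b h h' c => [] [] [] [] []. Qed.

(** The rung is forced: it is selected iff the upper vertex is not covered by [h'] or [c]. *)
Lemma site_vertex_ok (b h h' c : bool) :
  site b h h' c =
  vertex_ok (~~ (h' || c)) h b && vertex_ok (~~ (h' || c)) h' c.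
Proof. by move: b h h' c => [] [] [] []. Qed.

End Matchings.

Arguments level : simpl never.

(** * Matchings as paths of transfer matrices *)

Section Encoding.
Variables k' n' : nat.
Local Notation k := k'.+1.
Local Notation n := n'.+1.
Local Notation bits := {ffun 'I_n -> bool}.
Local Notation states := ({ffun 'I_k.+1 -> bits} * {ffun 'I_k -> bits})%type.
Implicit Types (M : {set edge k n}) (p : states) (t : 'I_k) (j : 'I_n).

(** Rungs are left out, being forced. Height is positive here because at height 0 the levels 0 and
    [k] coincide while bottom and top edges stay distinct. *)
Definition states_of M : states :=
  ([ffun t : 'I_k.+1 => [ffun j => level k t j \in M]],
   [ffun t => [ffun j => Horiz t j \in M]]).

Definition matching_of p : {set edge k n} :=
  [set e | match e with
           | Rung t j => ~~ (p.2 t j || p.1 (lift ord0 t) j)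
           | Horiz t j => p.2 t j
           | Vert s j => p.1 (inord s.+1) j
           | Bottom j => p.1 ord0 j
           | Top j => p.1 ord_max j
           end].

Lemma level_matching_of p (t : 'I_k.+1) j :
  (level k t j \in matching_of p) = p.1 t j.
Proof.
have [t_max|] := eqVneq t ord_max.
  by rewrite t_max level_top // inE.
case Et: (val t) => [|s] neq_t.
  by rewrite inE; congr (p.1 _ _); apply: val_inj.
have lt_s : (s < k.-1)%N.
  have := ltn_ord t; rewrite Et ltnS leq_eqVlt => /predU1P[|//] s_k.
  by case/eqP: neq_t; apply: val_inj; rewrite Et s_k.
rewrite -[s]/(val (Ordinal lt_s)) levelS inE /=; congr (p.1 _ _).
by apply: val_inj; rewrite /= inordK -Et ?ltn_ord.
Qed.

Lemma matching_ofK : cancel matching_of states_of.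
Proof.
case=> V H; congr (_, _).
  by apply/ffunP=> t; apply/ffunP=> j; rewrite !ffunE level_matching_of.
by apply/ffunP=> t; apply/ffunP=> j; rewrite !ffunE inE.
Qed.

Lemma states_ofK M : perfect_matching M -> matching_of (states_of M) = M.
Proof.
rewrite perfect_matchingE => /forallP ok; apply/setP=> -[t j|t j|s j|j|j];
  rewrite inE !ffunE //=.
- have /forallP/(_ j)/andP[_] := ok t.
  rewrite /vertex_ok -[level k (lift ord0 t) j]/(level k t.+1 j).
  by case: (Rung _ _ \in _); case: (Horiz _ _ \in _); case: (_ \in M).
- rewrite inordK ?levelS //; exact: ltnW (ltn_ord s).
- by rewrite level_top.
Qed.

Lemma perfect_matching_of p : perfect_matching (matching_of p) =
  [forall t, row_ok (p.1 (widen_ord (leqnSn k) t)) (p.2 t) (p.1 (lift ord0 t))].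
Proof.
rewrite perfect_matchingE; apply: eq_forallb => t; apply: eq_forallb => j.
rewrite (level_matching_of p (widen_ord (leqnSn k) t)).
rewrite (level_matching_of p (lift ord0 t)).
by rewrite !inE site_vertex_ok.
Qed.

Lemma card_Gamma (alpha mu nu : k.-tuple nat) :
  #|Gamma n alpha mu nu|%:R =
  entry (\prod_(a <- alpha) transfer n' a) (bstring n mu) (bstring n nu).
Proof.
rewrite big_tuple entry_prod -sum1_card natr_sum.
rewrite (reindex_onto matching_of states_of) => [|M]; last first.
  by rewrite inE => /and4P[+ _ _ _]; apply: states_ofK.
under [RHS]eq_bigr => V _.
  under eq_bigr do rewrite kernel_mxE.
  rewrite bigA_distr_bigA /=.
  under eq_bigr do rewrite prodr_nat_bool.
  over.
rewrite pair_big_dep /= big_mkcond [RHS]big_mkcond /=.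
apply: eq_bigr => -[V H] _; rewrite matching_ofK eqxx andbT inE /= andbT.
rewrite perfect_matching_of /=.
have -> : b_in (matching_of (V, H)) = V ord0.
  by apply/ffunP=> j; rewrite ffunE inE.
have -> : b_out (matching_of (V, H)) = V ord_max.
  by apply/ffunP=> j; rewrite ffunE inE.
have horizE t : horiz_in_row (matching_of (V, H)) t = (\sum_j H t j)%N.
  rewrite /horiz_in_row -sum1_card big_mkcond /=.
  by apply: eq_bigr => j _; rewrite !inE /=; case: (H t j).
case: (V ord0 == _); rewrite /= ?andbF //.
case: (V ord_max == _); rewrite /= ?andbF //.
set okH := [forall t, row_ok _ _ _]; set eq_alpha := [forall t, _ == _].
suff -> : [forall t, row_ok (V (widen_ord (leqnSn k) t)) (H t) (V (lift ord0 t)) &&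
    ((\sum_j H t j)%N == tnth alpha t)] = okH && eq_alpha by case: (okH && eq_alpha).
apply/forallP/andP => [ok | [/forallP rows_ok /forallP rows_alpha] t].
  by split; apply/forallP=> t; have /andP[] := ok t; rewrite ?horizE.
by rewrite rows_ok -horizE rows_alpha.
Qed.

End Encoding.

Lemma card_Gamma_perm (k n : nat) (alpha lambda mu nu : k.-tuple nat) :
  (0 < n)%N -> perm_eq alpha lambda ->
  #|Gamma n lambda mu nu| = #|Gamma n alpha mu nu|.
Proof.
(* At height 0 both tuples are empty, so the two sets are the same. *)
case: n => // n _; case: k alpha lambda mu nu => [|k] alpha lambda mu nu eq_al.
  by rewrite (tuple0 alpha) (tuple0 lambda).
apply/eqP; rewrite -(eqr_nat int) !card_Gamma.
by rewrite (transfer_perm _ eq_al).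
Qed.

Local Close Scope ring_scope.

(** * Displacement of positions and boundary crossings *)

Section Displacement.
Variables k n : nat.
Implicit Types (M : {set edge k n}) (t : 'I_k) (j : 'I_n).

Definition level_weight M (t : nat) := \sum_(j < n) j.+1 * (level k t j \in M).

Definition crossing_at M t := \sum_(j < n | j.+1 == n) (Horiz t j \in M).

Lemma ordS_succ j : (ordS j).+1 + n * (j.+1 == n) = j.+2.
Proof.
have [jn|] := eqVneq j.+1 n; first by rewrite /= jn modnn muln1 add1n.
by rewrite /= muln0 addn0 => neq_n; rewrite modn_small // ltn_neqAle neq_n ltn_ord.
Qed.

Lemma crossingsE M : crossings M = \sum_t crossing_at M t.
Proof.
rewrite /crossings -sum1_card pair_big_dep /= big_mkcond [RHS]big_mkcond /=.
apply: eq_bigr => -[t j] _; rewrite inE /=.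
by case: (_ == n) => //=; case: (_ \in M).
Qed.

Lemma horiz_in_rowE M t : horiz_in_row M t = \sum_(j < n) (Horiz t j \in M).
Proof.
rewrite /horiz_in_row -sum1_card big_mkcond /=.
by apply: eq_bigr => j _; rewrite inE; case: (_ \in M).
Qed.

Lemma row_displacement M t : perfect_matching M ->
  level_weight M t.+1 + n * crossing_at M t = level_weight M t + horiz_in_row M t.
Proof.
rewrite perfect_matchingE => /forallP/(_ t)/forallP ok.
pose h j : nat := Horiz t j \in M.
have balance j : (level k t j \in M) + h (ord_pred j) = h j + (level k t.+1 j \in M).
  by case/andP: (ok j) => okD okU; case/andP: (vertex_ok_site okD okU) => /eqP.
(* Adding this sum avoids subtraction: weighting [balance] by [j.+1] and shifting the index moves
   each horizontal dimer one column on, with [n] lost at the boundary. *)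
apply: (@addnI (\sum_(j < n) j.+1 * h j)).
have -> : n * crossing_at M t = \sum_(j < n) n * (j.+1 == n) * h j.
  rewrite big_distrr /= big_mkcond /=; apply: eq_bigr => j _.
  by case: (_ == n); rewrite ?muln1 // muln0 mul0n.
rewrite addnA -big_split /=.
transitivity (\sum_(j < n) j.+1 * (level k t j \in M) +
  \sum_(j < n) j.+1 * h (ord_pred j) + \sum_(j < n) n * (j.+1 == n) * h j).
  congr (_ + _); rewrite -big_split /=; apply: eq_bigr => j _.
  by rewrite -!mulnDr balance.
rewrite [X in _ + X + _](reindex (@ordS n)) /=; last first.
  by apply: onW_bij; exists (@ord_pred n); [exact: ordSK | exact: ord_predK].
rewrite -addnA -big_split /= addnCA; congr (_ + _).
rewrite horiz_in_rowE -big_split /=; apply: eq_bigr => j _.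
by rewrite ordSK -mulnDl ordS_succ mulSn addnC.
Qed.

Lemma total_displacement M : perfect_matching M ->
  level_weight M k + n * crossings M =
  level_weight M 0 + \sum_t horiz_in_row M t.
Proof.
move=> perfM; apply: (@addnI (\sum_(t < k) level_weight M t)).
rewrite addnA; have -> : \sum_(t < k) level_weight M t + level_weight M k =
    level_weight M 0 + \sum_(t < k) level_weight M t.+1.
  by transitivity (\sum_(t < k.+1) level_weight M t);
    [rewrite big_ord_recr | rewrite big_ord_recl].
rewrite -addnA [RHS]addnCA; congr (_ + _).
rewrite crossingsE big_distrr -!big_split /=.
by apply: eq_bigr => t _; apply: row_displacement.
Qed.

(** Adding the index turns the weakly increasing reversed parts into distinct positions between 1
    and [n]. The extra sum depends only on [k], so it cancels between [mu] and [nu]. *)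
Lemma bstring_weight (mu : k.-tuple nat) : k <= n -> in_Pi n mu ->
  \sum_(j < n) j.+1 * bstring n mu j = sumn mu + \sum_(i < k) i.+1.
Proof.
move=> le_kn /andP[mu_sorted /allP mu_le].
pose pos (i : 'I_k) := tnth mu (rev_ord i) + i.+1.
have pos_lt i : (pos i).-1 < n.
  by rewrite /pos addnS /= -(subnK le_kn) -addnS leq_add // mu_le // mem_tnth.
have pos_inj : injective pos.
  have mono (a b : 'I_k) : a < b -> pos a < pos b.
    move=> lt_ab; rewrite /pos -addnS leq_add // !(tnth_nth 0) /=.
    have := @sorted_leq_nth _ geq _ _ 0 mu mu_sorted; apply => //.
    - by move=> y x z /= yx zy; apply: leq_trans zy yx.
    - by move=> x; apply: leqnn.
    - by rewrite inE size_tuple rev_ord_proof.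
    - by rewrite inE size_tuple rev_ord_proof.
    - by rewrite leq_sub2l // ltnS ltnW.
  move=> i i' eq_pos; apply: val_inj => /=.
  by case: (ltngtP i i') => // /mono; rewrite eq_pos ltnn.
transitivity (\sum_(j < n) \sum_(i < k) j.+1 * (j.+1 == pos i)).
  apply: eq_bigr => j _; rewrite -big_distrr ffunE; congr (_ * _).
  case: existsP => [[i /eqP ji]|no_i].
    rewrite (bigD1 i) //= ji eqxx big1 // => i' neq_i.
    by apply/eqP; rewrite eqb0 (inj_eq pos_inj) eq_sym.
  rewrite big1 // => i _; apply/eqP; rewrite eqb0; apply/negP => ji.
  by apply: no_i; exists i.
rewrite exchange_big /=.
transitivity (\sum_i pos i).
  apply: eq_bigr => i _; rewrite (bigD1 (Ordinal (pos_lt i))) //=.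
  have posK : (pos i).-1.+1 = pos i by rewrite /pos addnS.
  rewrite posK eqxx muln1 big1 ?addn0 // => j.
  rewrite -val_eqE /= => neq_j; apply/eqP; rewrite muln_eq0 eqb0 /=.
  by rewrite -posK eqSS.
rewrite big_split; congr (_ + _).
rewrite sumnE big_tuple [RHS](reindex_inj rev_ord_inj) //.
Qed.

Lemma Gamma_displacement (lambda mu nu : k.-tuple nat) M :
  k <= n -> in_Pi n mu -> in_Pi n nu -> M \in Gamma n lambda mu nu ->
  sumn nu + n * crossings M = sumn mu + sumn lambda.
Proof.
move=> le_kn mu_Pi nu_Pi; rewrite inE.
move=> /and4P[perfM /eqP inM /eqP outM /forallP rowsM].
have lambdaE : sumn lambda = \sum_t horiz_in_row M t.
  by rewrite sumnE big_tuple; apply: eq_bigr => t _; apply/esym/eqP.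
have muE : level_weight M 0 = sumn mu + \sum_(i < k) i.+1.
  rewrite -bstring_weight // -inM.
  by apply: eq_bigr => j _; rewrite ffunE.
have nuE : level_weight M k = sumn nu + \sum_(i < k) i.+1.
  (* At height 0, level [k] consists of bottom edges, not top ones; as [mu] and [nu] are then both
     empty, [muE] serves instead. *)
  case: (posnP k) => [k0 | k_gt0].
    have nilE (u : k.-tuple nat) : u = [::] :> seq nat.
      by apply: size0nil; rewrite size_tuple.
    by rewrite -[RHS]/(sumn nu + _) nilE -(nilE mu) -muE; congr (level_weight M _).
  rewrite -bstring_weight // -outM.
  by apply: eq_bigr => j _; rewrite ffunE level_top.
have := total_displacement perfM; rewrite muE nuE -lambdaE.
by rewrite -!addnA ![(\sum_(i < k) _) + _]addnC !addnA; apply: addIn.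
Qed.

End Displacement.

Theorem theorem1 (n k : nat) (hn : 3 <= n) (hk : k <= n)
    (lambda mu nu : k.-tuple nat)
    (hlambda : in_Pi n lambda) (hmu : in_Pi n mu) (hnu : in_Pi n nu) :
  [/\ forall alpha : k.-tuple nat, perm_eq alpha lambda ->
        #|Gamma n lambda mu nu| = #|Gamma n alpha mu nu|,
      ~ (n %| ((sumn lambda)%:Z + (sumn mu)%:Z - (sumn nu)%:Z)%R)%Z ->
        #|Gamma n lambda mu nu| = 0
    & 0 < #|Gamma n lambda mu nu| ->
        forall M : {set edge k n}, M \in Gamma n lambda mu nu ->
          ((crossings M)%:Q =
            ((sumn lambda)%:Q + (sumn mu)%:Q - (sumn nu)%:Q) / n%:Q)%R].
Proof.
have n_gt0 : 0 < n by apply: leq_trans hn.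
have displacement (M : {set edge k n}) : M \in Gamma n lambda mu nu ->
    ((sumn lambda)%:Z + (sumn mu)%:Z - (sumn nu)%:Z = n%:Z * (crossings M)%:Z)%R.
  move=> /(Gamma_displacement hk hmu hnu) eqM.
  by rewrite -PoszD addnC -eqM PoszD PoszM addrC addKr.
split=> [alpha | not_dvd | _ M inM].
- exact: card_Gamma_perm.
- apply/eqP; rewrite cards_eq0; apply/set0Pn => -[M /displacement eqM].
  by apply: not_dvd; rewrite eqM dvdz_mulr.
rewrite -intrD -intrB (displacement M inM) intrM mulrC mulKr //.
by rewrite unitfE intr_eq0 -lt0n.
Qed.
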